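(* There is an absolute constant $a>0$ such that the following holds. Let $X$ be a finite or countable set and let $C\subseteq\{0,1\}^X$ be a concept class with VC dimension $d$, $0<d<\infty$, whose dual class $C^*$ has VC dimension $d^*$, $0<d^*<\infty$. Then $C$ has a sample compression scheme of size at most $k\log_2 k$, where $k=a\,d^*d$.
   Context: A concept class is a set $C\subseteq\{0,1\}^X$ of functions $X\to\{0,1\}$. A set $Y\subseteq X$ is $C$-shattered if for every $Z\subseteq Y$ there is $c\in C$ with $c(x)=1$ for all $x\in Z$ and $c(x)=0$ for all $x\in Y\setminus Z$; the VC dimension of $C$ is the maximum size of a $C$-shattered set. The dual class $C^*\subseteq\{0,1\}^C$ is the set of all functions $f_x:C\to\{0,1\}$, $x\in X$, defined by $f_x(c)=c(x)$. A $C$-labeled sample is a pair $(Y,y)$ where $Y$ is a finite multiset of elements of $X$ and $y=c|_Y$ for some $c\in C$; its size is the size of $Y$ as a multiset. $L_C(k)$ denotes the set of $C$-labeled samples of size at most $k$, and $L_C(\infty)$ the set of all finite $C$-labeled samples. A sample compression scheme for $C$ with kernel size $k$ and side information $I$ ($I$ a finite set) consists of a compression map $\kappa:L_C(\infty)\to L_C(k)\times I$ sending $(Y,y)$ to $((Z,z),i)$ with $Z\subseteq Y$ and $z=y|_Z$, and a reconstruction map $\rho:L_C(k)\times I\to\{0,1\}^X$ such that $\rho(\kappa(Y,y))|_Y=y$ for all $(Y,y)\in L_C(\infty)$. The size of the scheme is $k+\log_2|I|$. *)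

(* Defs.v *)
From Stdlib Require Import Reals List.
Import ListNotations.
Open Scope R_scope.

Definition log2 (x : R) : R := ln x / ln 2.

(* Generic shattering: ground points of type T restricted to the predicate D;
   K is a class of functions T -> bool (only their values on D matter).
   Y is a finite set of points of D, given as a duplicate-free list. *)
Definition shattered {T : Type} (D : T -> Prop) (K : (T -> bool) -> Prop)
  (Y : list T) : Prop :=
  NoDup Y /\ (forall y, In y Y -> D y) /\
  forall Z : T -> bool,
    exists g, K g /\ forall y, In y Y -> g y = Z y.

Definition VCdim_eq {T : Type} (D : T -> Prop) (K : (T -> bool) -> Prop)
  (d : nat) : Prop :=
  (exists Y, shattered D K Y /\ length Y = d) /\
  (forall Y, shattered D K Y -> (length Y <= d)%nat).

Definition VCdim {X : Type} (C : (X -> bool) -> Prop) (d : nat) : Prop :=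
  VCdim_eq (fun _ : X => True) C d.

Definition dual_class {X : Type} (C : (X -> bool) -> Prop)
  : ((X -> bool) -> bool) -> Prop :=
  fun g => exists x : X, forall c, C c -> g c = c x.

Definition dual_VCdim {X : Type} (C : (X -> bool) -> Prop) (d : nat) : Prop :=
  VCdim_eq C (dual_class C) d.

Definition countable (X : Type) : Prop :=
  exists f : X -> nat, forall x y, f x = f y -> x = y.

(* A labeled sample (a finite multiset of labeled points (x, b)) is
   represented by its multiplicity function: s x b = number of copies of x
   carrying label b. *)
Definition sample (X : Type) := X -> bool -> nat.

Definition supported_by {X : Type} (s : sample X) (l : list X) : Prop :=
  NoDup l /\ forall x b, (0 < s x b)%nat -> In x l.

Definition finite_sample {X : Type} (s : sample X) : Prop :=
  exists l, supported_by s l.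

Definition size_along {X : Type} (s : sample X) (l : list X) : nat :=
  fold_right (fun x acc => (s x true + s x false + acc)%nat) 0%nat l.

Definition size_le {X : Type} (s : sample X) (k : nat) : Prop :=
  exists l, supported_by s l /\ (size_along s l <= k)%nat.

Definition C_labeled {X : Type} (C : (X -> bool) -> Prop) (s : sample X) : Prop :=
  finite_sample s /\
  exists c, C c /\ forall x b, (0 < s x b)%nat -> c x = b.

Definition subsample {X : Type} (z s : sample X) : Prop :=
  forall x b, (z x b <= s x b)%nat.

(* Sample compression scheme with kernel size k and side information
   I = {0, ..., n-1}. *)
Definition compression_scheme {X : Type} (C : (X -> bool) -> Prop)
  (k n : nat) : Prop :=
  exists (kappa : sample X -> sample X * nat)
         (rho : sample X -> nat -> (X -> bool)),
    forall s, C_labeled C s ->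
      let Z := fst (kappa s) in
      let i := snd (kappa s) in
      (i < n)%nat /\ subsample Z s /\ size_le Z k /\
      (forall x b, (0 < s x b)%nat -> rho Z i x = b).

Definition scheme_size (k n : nat) : R := INR k + log2 (INR n).

(* Main.v *)
(* Given a sample, weak learning works from O(d) points: a concept consistent with a
   suitable tuple of O(d) points has error at most 1/8 with respect to any given weights
   on the sample (uniform convergence, proved by Sauer's lemma and a ghost sample).
   Boosting combines such concepts into a multiset that errs at each sample point with
   frequency at most 3/8. Seen from the dual class, uniform convergence again extracts
   O(dstar) of these concepts whose majority vote is right on the whole sample. The kernel
   consists of the O(d * dstar) points that generate them, and the side information says
   which of these points generate which concept. *)
From mathcomp Require all_boot all_order all_algebra boolp ring lra zify.
Require Import Defs.

Module Compression.
Import all_boot all_order all_algebra boolp ring lra zify.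
Set Implicit Arguments. Unset Strict Implicit. Unset Printing Implicit Defensive.
Import Order.TTheory GRing.Theory Num.Theory.
Local Open Scope nat_scope.

(** * Shattering in finite set systems and Sauer's lemma *)

Definition shatters (J : finType) (F : {set {set J}}) (S : {set J}) :=
  [forall Z : {set J}, (Z \subset S) ==> [exists A in F, A :&: S == Z]].

Lemma shattersP (J : finType) (F : {set {set J}}) (S : {set J}) :
  reflect (forall Z : {set J}, Z \subset S -> exists2 A, A \in F & A :&: S = Z)
          (shatters F S).
Proof.
apply: (iffP forallP) => [H Z ZS|H Z].
  by have /implyP/(_ ZS)/exists_inP[A AF /eqP] := H Z; exists A.
apply/implyP => /H[A AF <-]; apply/exists_inP; exists A => //.
Qed.

Lemma shattersS (J : finType) (F G : {set {set J}}) (S : {set J}) :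
  F \subset G -> shatters F S -> shatters G S.
Proof.
move=> FG /shattersP H; apply/shattersP => Z /H[A AF <-].
by exists A => //; apply: (subsetP FG).
Qed.

(* Split F along a point x on which its members disagree: a set shattered by
   both halves misses x, and adding x to it gives a further set shattered by F. *)
Lemma pajor (J : finType) (F : {set {set J}}) :
  #|F| <= #|[set S | shatters F S]|.
Proof.
have [n] := ubnP #|F|; elim: n F => // n IH F; rewrite ltnS => Fn.
have [F1|] := leqP #|F| 1.
  have [->|[A AF]] := set_0Vmem F; first by rewrite cards0.
  apply: leq_trans F1 _; rewrite card_gt0; apply/set0Pn; exists set0.
  rewrite inE; apply/shattersP => Z; rewrite subset0 => /eqP->.
  by exists A => //; rewrite setI0.
case/card_gt1P => A [B [AF BF neqAB]].
have [x xAB] : exists x, (x \in A) != (x \in B).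
  apply/existsP; apply: contraR neqAB; rewrite negb_exists => /forallP H.
  by apply/eqP/setP => x; apply/eqP; have:= H x; rewrite negbK.
pose F1 := [set S in F | x \in S]; pose F0 := [set S in F | x \notin S].
have FE : #|F| = #|F1| + #|F0|.
  rewrite -(cardsID [set S : {set J} | x \in S] F); congr (_ + _);
    by apply: eq_card => S; rewrite !inE // andbC.
have [F1_gt0 F0_gt0] : 0 < #|F1| /\ 0 < #|F0|.
  wlog xA : A B AF BF {neqAB} xAB / x \in A.
    case: (boolP (x \in A)) => xA H; first by apply: (H A B).
    by apply: (H B A) => //; move: xAB; rewrite (negPf xA); case: (x \in B).
  move: xAB; rewrite xA eq_sym eqb_id => xB.
  by split; rewrite card_gt0; apply/set0Pn; [exists A|exists B]; rewrite inE ?AF ?BF.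
have notin1 S : shatters F1 S -> x \notin S.
  move=> /shattersP /(_ set0 (sub0set _))[C]; rewrite inE => /andP[_ xC] /setP /(_ x).
  by rewrite !inE xC /= => ->.
have notin0 S : shatters F0 S -> x \notin S.
  move=> /shattersP /(_ S (subxx _))[C]; rewrite inE => /andP[_ xC] /setP /(_ x).
  by rewrite !inE (negPf xC) /= => <-.
set S1 := [set S | shatters F1 S]; set S0 := [set S | shatters F0 S].
have le1 : #|F1| <= #|S1| by apply: IH; lia.
have le0 : #|F0| <= #|S0| by apply: IH; lia.
have inj : {in S1 :&: S0 &, injective (fun S => x |: S)}.
  move=> S S'; rewrite !inE => /andP[/notin1 xS _] /andP[/notin1 xS' _] E.
  by rewrite -(setU1K xS) E setU1K.
(* A set shattered by both halves counts twice; the second copy is charged to the set with [x]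
   added, which lies in neither [S1] nor [S0]. *)
rewrite FE (leq_trans (leq_add le1 le0)) // -cardsUI -(card_in_imset inj).
rewrite -cardsUI [X in _ + X](_ : _ = 0) ?addn0; last first.
  apply/eqP; rewrite cards_eq0; apply/eqP/setP => S; rewrite !inE.
  apply/negP => /andP[H /imsetP[S' _ E]].
  by case/orP: H => [/notin1|/notin0]; rewrite E setU11.
apply/subset_leq_card/subsetP => S; rewrite !inE => /orP[/orP[]|].
- by apply: shattersS; apply/subsetP => C; rewrite inE => /andP[].
- by apply: shattersS; apply/subsetP => C; rewrite inE => /andP[].
case/imsetP => S'; rewrite !inE => /andP[H1 H0] ->{S}; apply/shattersP => Z ZS.
have xS' := notin1 _ H1.
have ZS' : Z :\ x \subset S' by rewrite subDset.
case: (boolP (x \in Z)) => xZ.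
  have /shattersP /(_ _ ZS')[C] := H1; rewrite inE => /andP[CF xC] E.
  exists C => //; rewrite setIUr E.
  have -> : C :&: [set x] = [set x] by apply/setIidPr; rewrite sub1set.
  by rewrite setD1K.
have /shattersP /(_ _ ZS')[C] := H0; rewrite inE => /andP[CF xC] E.
exists C => //; rewrite setIUr E.
have -> : C :&: [set x] = set0.
  by apply/setP => y; rewrite !inE; case: eqP => [->|]; rewrite ?(negPf xC) ?andbF.
by rewrite set0U; apply/setDidPl; rewrite disjoint_sym disjoints1.
Qed.

Local Open Scope ring_scope.

(** Give each [S] weight [w ^+ #|S|]: all subsets together weigh [(1 + w) ^+ #|J|], and a shattered
    one at least [w ^+ d]. A free [w] replaces the usual sum of binomials. *)
Lemma sauer (R : realFieldType) (J : finType) (F : {set {set J}}) (d : nat) (w : R) :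
  0 < w <= 1 -> (forall S, shatters F S -> #|S| <= d)%N ->
  #|F|%:R <= (1 + w) ^+ #|J| / w ^+ d.
Proof.
move=> /andP[w0 w1] H; rewrite ler_pdivlMr ?exprn_gt0 //.
apply: le_trans (_ : #|[set S | shatters F S]|%:R * w ^+ d <= _).
  by rewrite ler_wpM2r ?exprn_ge0 ?(ltW w0) // ler_nat pajor.
have -> : (1 + w) ^+ #|J| = \sum_(S : {set J}) w ^+ #|S|.
  rewrite addrC -prodr_const (bigA_distr _ _ (fun=> _) (fun=> _)).
  by apply: eq_bigr => S _; rewrite -big_mkcond /= prodr_const.
rewrite -sum1_card natr_sum mulr_suml [X in _ <= X](bigID [in [set S | shatters F S]]) /=.
rewrite ler_wpDr ?sumr_ge0 // => [S _|]; first by rewrite exprn_ge0 ?ltW.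
apply: ler_sum => S; rewrite inE mul1r => /H Sd.
by apply: ler_wiXn2l; rewrite // ltW.
Qed.

Local Close Scope ring_scope.

(** * Concentration of hits in random tuples *)

Definition hits (I T : finType) (q : {set T}) (t : I -> T) : nat :=
  \sum_(i : I) (t i \in q).

Lemma sum_hits (I T : finType) (q : {set T}) :
  #|T| * \sum_(t : {ffun I -> T}) hits q t = #|I| * #|q| * #|T| ^ #|I|.
Proof.
rewrite /hits exchange_big /= big_distrr /=.
rewrite -[X in X * _ * _]sum1_card !big_distrl /=; apply: eq_bigr => i _.
have E : \prod_(j : I) \sum_(x : T) (if j == i then (x \in q) : nat else 1) =
    \sum_(t : {ffun I -> T}) \prod_j (if j == i then (t j \in q) : nat else 1).
  exact: (bigA_distr_bigA (fun (j : I) (x : T) => if j == i then (x \in q) : nat else 1)).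
move: E; rewrite (bigD1 i) //= eqxx -big_mkcond sum1_card.
rewrite (eq_bigr (fun=> #|T|)); last first.
  by move=> j /negPf->; rewrite sum1_card.
rewrite prod_nat_const => E.
have -> : \sum_(t : {ffun I -> T}) (t i \in q) = #|q| * #|T| ^ #|predC1 i|.
  rewrite {}E; apply: eq_bigr => t _; rewrite (bigD1 i) //= eqxx big1 ?muln1 //.
  by move=> j /negPf->.
rewrite mul1n mulnCA -expnS; congr (_ * _ ^ _).
by rewrite cardC1 prednK //; apply/card_gt0P; exists i.
Qed.

(** The mean hit rate is at most [(g - 1) / 8], and the threshold [(2g - 1) / 16] is midway between
    this and [g / 8]. By Markov a fraction of at most [(2g - 2) / (2g - 1) <= 14 / 15] exceeds
    it. *)
Lemma markov_hits (I T : finType) (q : {set T}) (g : nat) :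
  0 < #|I| -> 0 < #|T| -> 0 < g <= 8 -> 8 * #|q| <= g.-1 * #|T| ->
  #|T| ^ #|I| <= 16 * #|[set s : {ffun I -> T} | 16 * hits q s <= g.*2.-1 * #|I|]|.
Proof.
move=> I0 T0 g8 qT.
set good := [set s | _]; set n := #|I|; set N := #|T|.
have E : #|~: good| * (g.*2.-1 * n) <= 16 * \sum_(t : {ffun I -> T}) hits q t.
  rewrite -sum_nat_const big_distrr /= [X in _ <= X](bigID [in ~: good]) /=.
  apply: leq_trans (leq_addr _ _); apply: leq_sum => t; rewrite !inE -ltnNge; exact: ltnW.
have {E} : #|~: good| * (g.*2.-1 * n) * N <= 16 * (n * #|q| * N ^ n).
  by rewrite -sum_hits -/N; nia.
have := cardsC good; rewrite card_ffun -/n -/N => E.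
have M0 : 0 < N ^ n by rewrite expn_gt0 T0.
move: (N ^ n) M0 E => M M0 E H.
have {H} : #|~: good| * g.*2.-1 * (n * N) <= 2 * g.-1 * M * (n * N) by nia.
rewrite leq_pmul2r ?muln_gt0 ?I0 //; nia.
Qed.

Local Open Scope ring_scope.

(** The induction step loses [x ^+ n] times [(n + 1) (1 - x)^2]. This form bounds powers of numbers
    just above 1 and also shows that powers of numbers below 1 become small. *)
Lemma bernoulli (R : realFieldType) (x : R) (n : nat) :
  0 <= x -> x ^+ n * (1 + n%:R * (1 - x)) <= 1.
Proof.
move=> x0; elim: n => [|n IH]; first by rewrite mul0r addr0 mulr1.
apply: le_trans IH; rewrite exprSr -mulrA ler_wpM2l ?exprn_ge0 // -natr1.
have : 0 <= n%:R * (1 - x) ^+ 2 + (1 - x) ^+ 2.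
  by have sq := sqr_ge0 (1 - x); rewrite addr_ge0 // mulr_ge0.
by rewrite !expr2; lra.
Qed.

Lemma chernoff_base (R : realFieldType) (y : R) :
  y = 17 / 16 -> (y + y^-1) ^+ 16 <= 2 ^+ 16 * (39 / 40 * y).
Proof.
move=> yE; have -> : y + y^-1 = 2 * (545 / 544) by rewrite yE; field.
rewrite exprMn ler_pM2l ?exprn_gt0 //.
have x0 : 0 <= 545 / 544 :> R by lra.
by have := bernoulli 16 x0; move: (_ ^+ 16) => z; lra.
Qed.

(* Chernoff's bound: the i-th swap contributes y ^ (a i - b i) or its inverse,
   where y = 17/16, and ((y + 1/y) / 2) ^ 16 <= 39/40 * y. *)
Lemma swap_tail (R : realFieldType) (I : finType) (a b : I -> bool) (m : nat) :
  #|I| = (16 * m)%N ->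
  #|[set r : {set I} | (\sum_i (if i \in r then b i : nat else a i) + m <=
                       \sum_i (if i \in r then a i : nat else b i))%N]|%:R
   <= 2 ^+ #|I| * (39 / 40) ^+ m :> R.
Proof.
move=> Im; set y : R := 17 / 16.
have y0 : 0 < y by rewrite /y; lra.
have y1 : 1 < y by rewrite /y; lra.
have yV : y + y^-1 = 2 * (545 / 544) by rewrite /y; field.
have yV0 : 0 < y^-1 by rewrite invr_gt0.
have th0 : 0 <= 39 / 40 :> R by lra.
set tail := [set r | _].
(* Exponential moment: the product over coordinates expands into one term per [r], and each [r] in
   [tail] contributes at least [y ^+ m]. *)
have key : y ^+ m * #|tail|%:R <= (y + y^-1) ^+ #|I|.
  apply: le_trans (_ : \prod_i (y ^+ a i / y ^+ b i + y ^+ b i / y ^+ a i) <= _); last first.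
    rewrite -prodr_const; apply: ler_prod => i _; apply/andP; split.
      by rewrite addr_ge0 // divr_ge0 // exprn_ge0 // ltW.
    by case: (a i) (b i) => [] []; rewrite ?expr1 ?expr0 ?divr1 ?div1r ?divff ?gt_eqF //; lra.
  rewrite (bigA_distr _ _ (fun i => y ^+ a i / y ^+ b i)) /=.
  rewrite -sum1_card natr_sum mulr_sumr [X in _ <= X](bigID [in tail]) /=.
  rewrite ler_wpDr ?sumr_ge0 //.
    move=> r _; apply: prodr_ge0 => i _.
    by case: ifP => _; rewrite divr_ge0 // exprn_ge0 // ltW.
  apply: ler_sum => r; rewrite inE mulr1 => H.
  rewrite (eq_bigr (fun i => y ^+ (if i \in r then a i : nat else b i) /
                             y ^+ (if i \in r then b i : nat else a i))); last first.
    by move=> i _; case: ifP.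
  rewrite prodf_div !prodrXr ler_pdivlMr ?exprn_gt0 // -exprD.
  by rewrite ler_weXn2l ?(ltW y1) // addnC.
have num := chernoff_base (erefl y).
have : y ^+ m * #|tail|%:R <= y ^+ m * (2 ^+ #|I| * (39 / 40) ^+ m).
  apply: le_trans key _; rewrite Im !exprM mulrCA -!exprMn [y * _]mulrC.
  by apply: lerXn2r; rewrite ?nnegrE ?exprn_ge0 ?addr_ge0 ?mulr_ge0 ?invr_ge0 ?(ltW y0).
by rewrite ler_pM2l ?exprn_gt0.
Qed.

(* Symmetrization with a ghost sample *)
Local Close Scope ring_scope.

(* Symmetrization: if every sample t were bad for some member of Q, then by Markov's
   inequality a ghost sample s would often witness a gap between its hits and those of t,
   whereas swapping random coordinates of s and t makes such a gap unlikely. *)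
Lemma ghost_sample (R : realFieldType) (I T : finType) (Q : {set {set T}}) (G : R) (g m : nat) :
  #|I| = 16 * m -> 0 < m -> 0 < #|T| -> 0 < g <= 8 ->
  (forall u : I * bool -> T, #|[set u @^-1: (q : {set T}) | q in Q]|%:R <= G)%R ->
  (16 * G * (39 / 40) ^+ m < 1 :> R)%R ->
  exists t : {ffun I -> T}, forall q, q \in Q ->
    8 * #|q| <= g.-1 * #|T| -> 8 * hits q t < g * #|I|.
Proof.
move=> Im m0 T0 g8 growth small.
have I0 : 0 < #|I| by rewrite Im; lia.
case: (boolP [exists t : {ffun I -> T}, [forall q in Q,
  (8 * #|q| <= g.-1 * #|T|) ==> (8 * hits q t < g * #|I|)]]) => [/existsP[t /forall_inP H]|].
  by exists t => q qQ; apply/implyP; exact: H.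
rewrite negb_exists => /forallP bad; exfalso; move/negP: (lt_geF small); apply.
(* A bad [t] has hit rate at least [g / 8], and Markov supplies [s] with rate at most
   [(2g - 1) / 16]; the difference, 1/16 of the [16 * m] coordinates, is [m]. *)
pose gap (s t : I -> T) := [exists q in Q, hits q s + m <= hits q t].
pose P : finType := ({ffun I -> T} * {ffun I -> T})%type.
set n := #|I|; set N := #|T|.
have N0 : 0 < N ^ n by rewrite expn_gt0 T0.
have low : N ^ n * N ^ n <= 16 * \sum_(p : P) gap p.1 p.2.
  rewrite -(pair_bigA _ (fun s t : {ffun I -> T} => gap s t : nat)) exchange_big /=.
  apply: (@leq_trans (\sum_(t : {ffun I -> T}) N ^ n)); first by rewrite sum_nat_const card_ffun.
  rewrite big_distrr; apply: leq_sum => t _ /=.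
  have := bad t; rewrite negb_forall_in => /exists_inP[q qQ].
  rewrite negb_imply -leqNgt => /andP[qT qt].
  apply: leq_trans (markov_hits I0 T0 g8 qT) _; rewrite leq_mul2l /= -sum1dep_card big_mkcond.
  apply: leq_sum => s _; case: ifP => // Hs; rewrite lt0b.
  apply/exists_inP; exists q => //; rewrite Im in Hs qt; nia.
pose sw (r : {set I}) (p : P) : P := ([ffun i => if i \in r then p.2 i else p.1 i],
                                    [ffun i => if i \in r then p.1 i else p.2 i]).
have swK r : involutive (sw r).
  case=> s t; rewrite /sw /=; congr (_, _); apply/ffunP => i;
    by rewrite !ffunE; case: (i \in r).
have eq_sw : 2 ^ n * \sum_(p : P) gap p.1 p.2 =
    \sum_(p : P) \sum_(r : {set I}) gap (sw r p).1 (sw r p).2.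
  rewrite exchange_big /= -[X in X * _](_ : #|{set I}| = _); last first.
    by rewrite -[LHS]cardsT -powersetT card_powerset cardsT.
  rewrite -sum_nat_const; apply: eq_bigr => r _.
  by rewrite (reindex_inj (inv_inj (swK r))).
(* For a fixed pair, a gap after swapping depends only on the trace of [q] on the listed points: a
   union bound over at most [G] traces. *)
have up (p : P) : ((\sum_(r : {set I}) gap (sw r p).1 (sw r p).2)%:R <=
    G * (2 ^+ n * (39 / 40) ^+ m) :> R)%R.
  pose u (x : I * bool) := if x.2 then p.2 x.1 else p.1 x.1.
  pose tail (A : {set I * bool}) := [set r : {set I} |
    \sum_i (if i \in r then (i, true) \in A : nat else ((i, false) \in A)) + m <=
    \sum_i (if i \in r then (i, false) \in A : nat else ((i, true) \in A))].
  set im := [set u @^-1: (q : {set T}) | q in Q].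
  apply: (@le_trans _ _ (\sum_(A in im) #|tail A|)%:R%R).
    rewrite ler_nat; under [X in _ <= X]eq_bigr do rewrite -sum1_card big_mkcond.
    rewrite exchange_big /=; apply: leq_sum => r _.
    case: (boolP (gap _ _)) => // /exists_inP[q qQ H].
    rewrite (bigD1 (u @^-1: q)) ?imset_f //= [X in _ <= X + _](_ : _ = 1) //.
    rewrite inE; suff -> : (\sum_i (if i \in r then (i, true) \in u @^-1: q : nat
        else ((i, false) \in u @^-1: q)) + m <=
      \sum_i (if i \in r then (i, false) \in u @^-1: q : nat
        else ((i, true) \in u @^-1: q))) by [].
    apply: etrans H; congr (_ + _ <= _); apply: eq_bigr => i _;
      by rewrite !inE !ffunE /u /=; case: ifP.
  rewrite natr_sum.
  apply: (@le_trans _ _ (\sum_(A in im) (2 ^+ n * (39 / 40) ^+ m))%R).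
    by apply: ler_sum => A _; exact: (swap_tail R (fun i => (i, false) \in A) (fun i => (i, true) \in A) Im).
  rewrite sumr_const -[X in (X <= _)%R]mulr_natl ler_wpM2r ?growth //.
  by rewrite mulr_ge0 ?exprn_ge0 ?divr_ge0.
have upper : ((2 ^ n * \sum_(p : P) gap p.1 p.2)%:R <=
    (N ^ n * N ^ n)%:R * (G * (2 ^+ n * (39 / 40) ^+ m)) :> R)%R.
  rewrite eq_sw natr_sum; apply: le_trans (ler_sum _ (fun p _ => up p)) _.
  by rewrite sumr_const card_prod !card_ffun [X in (_ <= X)%R]mulr_natl.
have {low} : ((2 ^ n * (N ^ n * N ^ n))%:R <=
    (N ^ n * N ^ n)%:R * (16 * (G * (2 ^+ n * (39 / 40) ^+ m))) :> R)%R.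
  apply: (@le_trans _ _ (16 * (2 ^ n * \sum_(p : P) gap p.1 p.2))%:R%R).
    by rewrite ler_nat [X in _ <= X]mulnCA leq_mul2l low orbT.
  by rewrite natrM [X in (_ <= X)%R]mulrCA ler_wpM2l.
rewrite natrM natrX mulrC; set M := ((N ^ n * N ^ n)%:R)%R.
have M0 : (0 < M :> R)%R by rewrite ltr0n muln_gt0 N0.
rewrite ler_pM2l //.
rewrite [X in (_ <= X)%R](_ : _ = 2 ^+ n * (16 * G * (39 / 40) ^+ m))%R; last by ring.
by rewrite ler_pMr ?exprn_gt0.
Qed.

(** * From VC dimension to uniform convergence *)

Lemma In_mem (J : eqType) (x : J) (s : seq J) : List.In x s <-> x \in s.
Proof.
elim: s => //= y s IH; rewrite inE IH.
by split=> [[->|->]|/predU1P[->|]]; rewrite ?eqxx ?orbT; auto.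
Qed.

Lemma NoDup_map (J : eqType) (T : Type) (u : J -> T) (s : seq J) :
  uniq s -> {in s &, injective u} -> List.NoDup (map u s).
Proof.
elim: s => [|j s IH] /=; first by constructor.
move=> /andP[js us] inj; constructor; last first.
  by apply: IH => // a b sa sb; apply: inj; rewrite inE ?sa ?sb orbT.
move=> /List.in_map_iff[i [E /In_mem si]].
have : i = j by apply: inj => //; rewrite inE ?eqxx ?si ?orbT.
by move=> ij; rewrite -ij si in js.
Qed.

(** Although [u] may repeat points, it is injective on a shattered [S]: the member cutting out [{i}]
    separates [i] from the other indices. *)
Lemma pullback_shattered (T : Type) (D : T -> Prop) (K : (T -> bool) -> Prop) (d : nat)
    (J : finType) (u : J -> T) (F : {set {set J}}) :
  (forall Y, shattered D K Y -> (length Y <= d)%coq_nat) -> (forall j, D (u j)) ->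
  (forall A, A \in F -> exists2 f, K f & A = [set j | f (u j)]) ->
  forall S, shatters F S -> #|S| <= d.
Proof.
move=> VC Du FK S /shattersP sh.
suff /VC : shattered D K (map u (enum S)).
  by rewrite List.length_map => /ssrnat.leP; rewrite cardE.
split; [|split].
- apply: NoDup_map (enum_uniq _) _ => i j; rewrite !mem_enum => Si Sj uij.
  have [|A /FK[f _ ->] /setP E] := sh [set i]; first by rewrite sub1set.
  move: (E i) (E j); rewrite !inE uij Si Sj !andbT eqxx => -> /esym/eqP.
  by move=> ->.
- by move=> y /List.in_map_iff[j [<- _]].
move=> Z; have [|A /FK[f Kf ->] /setP E] := sh [set j in S | Z (u j)].
  by apply/subsetP => j; rewrite inE => /andP[].
exists f; split=> // y /List.in_map_iff[j [<- /In_mem]].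
by rewrite mem_enum => Sj; have := E j; rewrite !inE Sj andbT.
Qed.

Local Open Scope ring_scope.

Lemma expr_lt_small (R : archiRealFieldType) (x c : R) : 0 <= x < 1 -> 0 < c -> exists2 n, (0 < n)%N & x ^+ n < c.
Proof.
move=> /andP[x0 x1] c0; have y0 : 0 < (1 - x) * c by rewrite mulr_gt0 // subr_gt0.
set n := (Num.bound ((1 - x) * c)^-1).+1; exists n => //.
have nP : 1 < n%:R * ((1 - x) * c).
  rewrite -ltr_pdivrMr // div1r; apply: lt_trans (archi_boundP _) _.
    by rewrite invr_ge0 ltW.
  by rewrite ltr_nat.
have := bernoulli n x0; rewrite leNgt; apply: contraNlt => cx.
apply: lt_le_trans (_ : c * (1 + n%:R * (1 - x)) <= _); first by lra.
by rewrite ler_wpM2r // addr_ge0 // mulr_ge0 // subr_ge0 ltW.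
Qed.

(** This is the smallness condition of [ghost_sample], with Sauer's bound on a double sample of
    [32 * (k * d)] points and a factor 2 for two signs. The point is that [k] does not depend on
    [d]. *)
Lemma sample_size_factor (R : archiRealFieldType) :
  exists w : R, 0 < w <= 1 /\ exists2 k, (0 < k)%N & forall d, (0 < d)%N ->
    16 * (2 * ((1 + w) ^+ (32 * (k * d)) / w ^+ d)) * (39 / 40) ^+ (k * d) < 1.
Proof.
(* Here [(1 + w) ^+ 32 < 40 / 39], so the growth of traces loses to the Chernoff factor; [k] then
   absorbs [32 / w]. *)
set w : R := 1 / 2048; have w0 : 0 < w by rewrite /w; lra.
have w1 : 0 <= 1 + w by lra.
have [k k0 wk] : exists2 k, (0 < k)%N & ((1 + w) ^+ 32 * (39 / 40)) ^+ k < w / 32.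
  apply: expr_lt_small; last by lra.
  have : (1 + w) ^+ 32 < 40 / 39.
    by have := bernoulli 32 w1; move: (_ ^+ 32) => z; rewrite /w; lra.
  have : 0 <= (1 + w) ^+ 32 by rewrite exprn_ge0.
  by move: (_ ^+ 32) => z; lra.
exists w; split; first by rewrite w0 /w; lra.
exists k => // d d0.
have -> : 16 * (2 * ((1 + w) ^+ (32 * (k * d)) / w ^+ d)) * (39 / 40) ^+ (k * d) =
          32 * (((1 + w) ^+ 32 * (39 / 40)) ^+ k / w) ^+ d.
  rewrite [in RHS]expr_div_n -[in RHS]exprM [in RHS]exprMn -[in RHS]exprM.
  by move: (w ^+ d) (_ ^+ (k * d)) (_ ^+ (32 * _)) => ? ? ?; rewrite -!mulrA; ring.
set x := (_ / w).
have x_ge0 : 0 <= x.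
  by rewrite divr_ge0 ?(ltW w0) // exprn_ge0 // mulr_ge0 ?exprn_ge0 //; lra.
have x1 : x < 32^-1 by rewrite ltr_pdivrMr // [X in _ < X]mulrC.
have : x ^+ d <= x by rewrite -[X in _ <= X]expr1; apply: ler_wiXn2l => //; lra.
by lra.
Qed.

Local Close Scope ring_scope.

(* The sign b serves the dual class, where x errs at the concepts f with f x != c x:
   a dual function if c x = false, the complement of one otherwise. *)
Lemma uniform_sample : exists2 k, 0 < k &
  forall (T : Type) (D : T -> Prop) (K : (T -> bool) -> Prop) (d : nat)
    (J : finType) (e : J -> T) (g : nat),
  (forall Y, shattered D K Y -> (length Y <= d)%coq_nat) -> 0 < d ->
  (forall j, D (e j)) -> 0 < #|J| -> 0 < g <= 8 ->
  exists t : {ffun 'I_(k * d) -> J}, forall f b, K f ->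
    let q := [set j | f (e j) (+) b] in
    8 * #|q| <= g.-1 * #|J| -> 8 * hits q t < g * (k * d).
Proof.
have [w [w01 [k k0 wk]]] := sample_size_factor rat.
have w0 : (0 < w)%R by case/andP: w01.
exists (16 * k) => [|T D K d J e g VC d0 De J0 g8]; first by rewrite muln_gt0.
pose Q b := [set q : {set J} | `[< exists2 f, K f & q = [set j | f (e j) (+) b] >]].
(* Complementation injects the traces of sign [true] into those of sign [false]. *)
have pre b (u : 'I_(16 * k * d) * bool -> J) :
    #|[set u @^-1: (q : {set J}) | q in Q b]| <= #|[set u @^-1: (q : {set J}) | q in Q false]|.
  case: b => //.
  have C_inj : injective (fun A : {set 'I_(16 * k * d) * bool} => ~: A) by exact: setC_inj.
  rewrite -(card_imset _ C_inj); apply/subset_leq_card/subsetP => A.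
  case/imsetP => _ /imsetP[q + ->] ->; rewrite inE => /asboolP[f Kf ->].
  apply/imsetP; exists [set j | f (e j) (+) false].
    by rewrite inE; apply/asboolP; exists f.
  by apply/setP => x; rewrite !inE addbF addbT negbK.
pose m := k * d; pose G := (2 * ((1 + w) ^+ (32 * m) / w ^+ d))%R.
have growth (u : 'I_(16 * k * d) * bool -> J) :
    (#|[set u @^-1: (q : {set J}) | q in Q false :|: Q true]|%:R <= G)%R.
  rewrite imsetU /G mulr_natl mulr2n.
  apply: le_trans (_ : (#|[set u @^-1: (q : {set J}) | q in Q false]| +
                        #|[set u @^-1: (q : {set J}) | q in Q true]|)%:R <= _)%R.
    by rewrite ler_nat -cardsUI leq_addr.
  have S : (#|[set u @^-1: (q : {set J}) | q in Q false]|%:R <=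
            (1 + w) ^+ (32 * m) / w ^+ d)%R.
    have -> : 32 * m = #|{: 'I_(16 * k * d) * bool}|.
      by rewrite card_prod card_ord card_bool /m; lia.
    apply: sauer => // S; apply: (pullback_shattered (u := e \o u) VC) => //= A.
    case/imsetP => q; rewrite inE => /asboolP[f Kf ->] ->; exists f => //.
    by apply/setP => x; rewrite !inE addbF.
  by rewrite natrD lerD // (le_trans _ S) // ler_nat pre.
have small : (16 * G * (39 / 40) ^+ m < 1)%R by apply: wk.
have [||t tP] := @ghost_sample rat 'I_(16 * k * d) J (Q false :|: Q true) G g m _ _ J0 g8 growth small.
- by rewrite card_ord mulnA.
- by rewrite muln_gt0 k0.
exists t => f b Kf q qJ; rewrite -[X in _ < _ * X]card_ord; apply: tP => //.
by rewrite !inE; apply/orP; case: b @q qJ => q _; [right|left]; apply/asboolP; exists f.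
Qed.

(** * Boosting by multiplicative weights *)

(** Think of [a = 9], [b = 8] and [8 * n] rounds. Were the conclusion false, the eighth power of the
    weight bound would give [2 ^ (8 * n) <= n ^ 8], against [n < 2 ^ n]. *)
Lemma error_rate (a b n e : nat) :
  a ^ 8 <= 4 * b ^ 8 -> b = 2 ^ 3 -> b ^ (8 * n) * 2 ^ e <= a ^ (8 * n) * n -> 0 < n ->
  8 * e <= 3 * (8 * n).
Proof.
move=> ab b8 W n0; rewrite leqNgt; apply/negP => eT; move: W eT; set T := 8 * n => W eT.
have b0 : 0 < b by rewrite b8.
have : (b ^ T) ^ 8 * b ^ T <= (b ^ T) ^ 8 * (4 ^ T * n ^ 8).
  apply: (@leq_trans ((b ^ T) ^ 8 * (2 ^ e) ^ 8)).
    rewrite leq_mul2l [X in X ^ T <= _]b8 -(expnM 2 3) -(expnM 2 e) leq_exp2l //.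
    by rewrite (leq_trans (ltnW eT)) ?orbT // mulnC.
  have : (b ^ T * 2 ^ e) ^ 8 <= (a ^ T * n) ^ 8 by rewrite leq_exp2r.
  rewrite (expnMn (b ^ T)) (expnMn (a ^ T)) => /leq_trans; apply.
  rewrite mulnA leq_mul2r; apply/orP; right.
  rewrite -(expnM a) -(expnM b) (mulnC T) (expnM a) (expnM b) -expnMn mulnC.
  by rewrite leq_exp2r // muln_gt0.
rewrite leq_pmul2l ?expn_gt0 ?b0 // [b]b8 -[2 ^ 3]/(4 * 2) expnMn leq_pmul2l ?expn_gt0 //.
by rewrite /T mulnC expnM leq_exp2r // leqNgt ltn_expl.
Qed.

(** Take fourth powers in [81 * 3 = 243 <= 256 = 64 * 4]. *)
Lemma nine_eight_ratio : 9 ^ 8 <= 4 * 8 ^ 8.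
Proof.
have : (9 ^ 2 * 3) ^ 4 <= (8 ^ 2 * 4) ^ 4 by rewrite leq_exp2r.
rewrite (expnMn (9 ^ 2)) (expnMn (8 ^ 2)) -(expnM 9) -(expnM 8) -[3 ^ 4]/81 -[4 ^ 4]/256.
move: (9 ^ _) (8 ^ _) => a b; lia.
Qed.

(* Multiplicative weights, doubling the weight of a point at each error: the total
   weight grows by at most 9/8 per round, and (9/8)^8 < 2^3. *)
Lemma boosting (Y : finType) (H : Type) (err : H -> Y -> bool) :
  0 < #|Y| ->
  (forall wt : Y -> nat, (forall y, 0 < wt y) ->
     exists h, 8 * \sum_y err h y * wt y <= \sum_y wt y) ->
  exists hs : seq H, 0 < size hs /\
    forall y, 8 * count (err^~ y) hs <= 3 * size hs.
Proof.
move=> Y0 weak.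
have [hs sz W] : exists2 hs : seq H, size hs = 8 * #|Y| &
    8 ^ size hs * \sum_y 2 ^ count (err^~ y) hs <= 9 ^ size hs * #|Y|.
  elim: (8 * #|Y|) => [|n [hs sz IH]].
    by exists [::] => //=; rewrite sum_nat_const muln1 !mul1n.
  have [|h hP] := weak (fun y => 2 ^ count (err^~ y) hs).
    by move=> y; rewrite expn_gt0.
  exists (h :: hs); first by rewrite /= sz.
  rewrite /= !expnS; under eq_bigr => y _.
    rewrite (_ : 2 ^ _ = 2 ^ count (err^~ y) hs + err h y * 2 ^ count (err^~ y) hs); last first.
      by case: (err h y); rewrite /= ?expnS ?mul1n ?mul0n ?addn0 ?mul2n -?addnn.
    over.
  rewrite big_split /= -!mulnA (leq_trans _ (leq_mul (leqnn 9) IH)) // mulnCA [X in _ <= X]mulnCA.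
  by rewrite leq_mul2l mulnDr; apply/orP; right; lia.
exists hs; split=> [|y]; first by rewrite sz muln_gt0.
have {}W : 8 ^ size hs * 2 ^ count (err^~ y) hs <= 9 ^ size hs * #|Y|.
  by apply: leq_trans W; rewrite leq_mul2l (bigD1 y) //= leq_addr orbT.
by rewrite sz in W *; exact: (error_rate nine_eight_ratio (erefl (2 ^ 3)) W Y0).
Qed.

(** * Consistent learners and their majority vote *)

Definition consistent (X : Type) (C : (X -> bool) -> Prop) (I : Type) (v : I -> X * bool)
  (h : X -> bool) := C h /\ forall i, h (v i).1 = (v i).2.

(** The choice depends on [C] and the labelled tuple alone, so reconstruction finds the same concept
    as compression. *)
Definition learn (X : Type) (C : (X -> bool) -> Prop) (I : Type) (v : I -> X * bool) :
    X -> bool :=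
  if pselect (exists h, consistent C v h) is left ex then projT1 (cid ex) else fun=> false.

Lemma learnP (X : Type) (C : (X -> bool) -> Prop) (I : Type) (c : X -> bool) (v : I -> X) :
  C c -> consistent C (fun i => (v i, c (v i))) (learn C (fun i => (v i, c (v i)))).
Proof.
move=> Cc; rewrite /learn; case: pselect => [ex|[]]; first by case: (cid ex).
by exists c.
Qed.

Definition majority (X : Type) (m : nat) (h : 'I_m -> X -> bool) (x : X) :=
  m < 2 * \sum_(i < m) h i x.

(** Weights become multiplicities, so that [uniform_sample], which counts uniformly, applies to
    weighted points. *)
Lemma card_tagged_set (Y : finType) (wt : Y -> nat) (P : pred Y) :
  #|[set j : {y : Y & 'I_(wt y)} | P (tag j)]| = \sum_y P y * wt y.
Proof.
rewrite -sum1dep_card big_mkcond /=.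
rewrite (eq_bigr (fun j => P (tag j) : nat)) => [|j _]; last by case: (P _).
rewrite -(sig_big_dep xpredT (fun _ => xpredT) (fun y _ => P y : nat)) /=.
by apply: eq_bigr => y _; rewrite sum_nat_const card_ord mulnC.
Qed.

(** Boosting gives a list of uncontrolled length; a second use of [uniform_sample], on the dual
    class with this list as ground set, thins it to [k * dstar] learners. *)
Lemma majority_of_learners : exists2 k, 0 < k &
  forall (X : Type) (C : (X -> bool) -> Prop) (d dstar : nat),
  VCdim C d -> 0 < d -> dual_VCdim C dstar -> 0 < dstar ->
  forall (Y : finType) (p : Y -> X) (c : X -> bool), 0 < #|Y| -> C c ->
  exists u : 'I_(k * dstar) -> 'I_(k * d) -> Y, forall y,
    majority (fun i => learn C (fun j => (p (u i j), c (p (u i j))))) (p y) = c (p y).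
Proof.
have [k k0 sampling] := uniform_sample; exists k => //.
move=> X C d dstar [_ VC] d0 [_ VC'] ds0 Y p c Y0 Cc.
pose hyp (t : 'I_(k * d) -> Y) := learn C (fun j => (p (t j), c (p (t j)))).
have hypP t : consistent C (fun j => (p (t j), c (p (t j)))) (hyp t).
  exact: (learnP (fun j => p (t j)) Cc).
pose err t y := hyp t (p y) (+) c (p y).
have [wt wt0|hs [sz0 hsP]] := boosting (err := err) Y0.
  pose J : finType := {y : Y & 'I_(wt y)}.
  have cardJ : #|J| = \sum_y wt y by rewrite card_tagged sumnE big_map big_enum; apply: eq_bigr => y _; rewrite card_ord.
  have J0 : 0 < #|J|.
    by case/card_gt0P: Y0 => y _; rewrite cardJ (bigD1 y) //= ltn_addr.
  (* These functions mark the errors against [c]; adding a fixed [c] preserves shattering. *)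
  pose K f := exists2 h, C h & f = fun x => h x (+) c x.
  have VCK Z : shattered (fun _ : X => True) K Z -> (length Z <= d)%coq_nat.
    move=> [nd [_ sh]]; apply: VC; split=> //; split=> // V.
    have [_ [[h Ch ->] E]] := sh (fun x => V x (+) c x).
    by exists h; split=> // x /E /(congr1 (addb^~ (c x))); rewrite -!addbA addbb !addbF.
  (* With [g = 8], a set containing every sampled point covers more than 7/8 of [J]; the agreement
     set of a consistent concept is one. *)
  have [] // := sampling X (fun=> True) K d J (fun j => p (tag j)) 8 VCK d0 _ J0 _.
  move=> t tP; exists (fun j => tag (t j)).
  set h := fun j => tag (t j).
  have Kh : K (fun x => hyp h x (+) c x) by exists (hyp h) => //; case: (hypP h).
  have /= := tP _ true Kh; set q := [set j | _] => qP.
  have hq : hits q t = k * d.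
    rewrite /hits (eq_bigr (fun=> 1)) => [|i _]; first by rewrite sum1_card card_ord.
    by rewrite inE; have [_ /(_ i)/= ->] := hypP h; rewrite addbb.
  rewrite -card_tagged_set -cardJ; have := cardsC q.
  have -> : ~: q = [set j | err h (tag j)].
    by apply/setP => j; rewrite !inE addbT negbK.
  have : 7 * #|J| < 8 * #|q| by rewrite ltnNge; apply/negP => /qP; rewrite hq ltnn.
  by move: #|q| #|J| #|[set j | err h (tag j)]| => a n b; lia.
pose J : finType := 'I_(size hs).
(* With [g = 4], error rate at most 3/8 on the list becomes less than 1/2 on the sampled members. *)
have [] // := sampling _ C (dual_class C) dstar J (fun j => hyp (tnth (in_tuple hs) j)) 4 VC' ds0 _ _ _.
- by move=> j; case: (hypP (tnth (in_tuple hs) j)).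
- by rewrite card_ord.
move=> s sP; exists (fun i => tnth (in_tuple hs) (s i)) => y.
have dual_y : dual_class C (fun h => h (p y)) by exists (p y).
have /= := sP _ (c (p y)) dual_y; set q := [set j | _] => qP.
have qE : #|q| = count (err^~ y) hs.
  by rewrite -sum1_count big_tnth -sum1_card; apply: eq_bigl => j; rewrite inE.
have {qP qE hsP}: 8 * hits q s < 4 * (k * dstar).
  by apply: qP; rewrite qE card_ord; apply: hsP.
rewrite /hits (eq_bigr (fun i => (hyp (tnth (in_tuple hs) (s i)) (p y) (+) c (p y)) : nat));
  last by move=> i _; rewrite inE.
rewrite /majority -[\sum_(i < _) learn _ _ _]/(\sum_(i < k * dstar)
  hyp (tnth (in_tuple hs) (s i)) (p y)).
case: (c (p y)); last first.
  under eq_bigr do rewrite addbF.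
  by move: (\sum_i _) => a; lia.
have : \sum_(i < k * dstar) (hyp (tnth (in_tuple hs) (s i)) (p y) (+) true) +
       \sum_(i < k * dstar) hyp (tnth (in_tuple hs) (s i)) (p y) = k * dstar.
  rewrite -big_split /= (eq_bigr (fun=> 1)); first by rewrite sum1_card card_ord.
  by move=> i _; case: (hyp _ _).
move: (\sum_i _) => a; move: (\sum_i _) => b; lia.
Qed.

(** * Encoding a sample by kernel and side information *)

(** The list is chosen from [z] alone, so compression and reconstruction number the kernel points
    alike. *)
Definition support_seq (X : Type) (z : sample X) : seq X :=
  if pselect (exists l, List.NoDup l /\ forall x, List.In x l <-> exists b, 0 < z x b)
  is left ex then projT1 (cid ex) else [::].

Lemma support_seqP (X : Type) (z : sample X) : finite_sample z ->
  List.NoDup (support_seq z) /\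
  forall x, List.In x (support_seq z) <-> exists b, 0 < z x b.
Proof.
case=> l [nd lP]; rewrite /support_seq; case: pselect => [ex|[]]; first by case: (cid ex).
exists (List.filter (fun x => `[< exists b, 0 < z x b >]) l); split.
  exact: List.NoDup_filter.
move=> x; rewrite List.filter_In; split=> [[_ /asboolP]//|xz]; split; last exact/asboolP.
by case: xz => b /ssrnat.ltP /lP.
Qed.

Lemma In_nth (X : Type) (l : seq X) (x : X) :
  List.In x l -> exists2 i, i < size l & forall x0, nth x0 l i = x.
Proof.
elim: l => //= y l IH [->|/IH[i il iP]]; first by exists 0.
by exists i.+1.
Qed.

Lemma nth_In (X : Type) (l : seq X) (x0 : X) (i : nat) :
  i < size l -> List.In (nth x0 l i) l.
Proof. by elim: l i => //= y l IH [|i] il; [left|right; apply: IH]. Qed.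

Lemma size_along_le (X : Type) (z : sample X) (l : seq X) :
  (forall x, z x true + z x false <= 1) -> size_along z l <= size l.
Proof.
by move=> z1; elim: l => //= x l IH; have := leq_add (z1 x) IH; rewrite add1n.
Qed.

(* The side information tells, for each of the a learners, which b points of the
   (at most a * b) kernel points it is trained on. *)
Definition code (a b : nat) : finType := {ffun 'I_a * 'I_b -> 'I_(a * b)}.

Definition decode (a b : nat) (ab0 : 0 < a * b) (i : nat) : code a b :=
  nth [ffun=> Ordinal ab0] (enum (code a b)) i.

(* The default value x of nth is never reached on compressed samples. *)
Definition reconstruct (X : Type) (C : (X -> bool) -> Prop) (a b : nat) (ab0 : 0 < a * b)
    (z : sample X) (i : nat) (x : X) : bool :=
  majority (fun r : 'I_a => learn C (fun j : 'I_b =>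
    let y := nth x (support_seq z) (decode ab0 i (r, j)) in (y, 0 < z y true))) x.

Lemma compression_scheme_of_majority (X : Type) (C : (X -> bool) -> Prop) (a b : nat) :
  0 < a * b ->
  (forall (Y : finType) (p : Y -> X) (c : X -> bool), 0 < #|Y| -> C c ->
    exists u : 'I_a -> 'I_b -> Y, forall y,
      majority (fun i => learn C (fun j => (p (u i j), c (p (u i j))))) (p y) = c (p y)) ->
  compression_scheme C (a * b) ((a * b) ^ (a * b)).
Proof.
move=> ab0 maj.
have card_code : #|code a b| = (a * b) ^ (a * b) by rewrite card_ffun card_prod !card_ord.
suff /choice[kappa kappaP] : forall s, exists zi : sample X * nat, C_labeled C s ->
    (zi.2 < (a * b) ^ (a * b))%coq_nat /\ subsample zi.1 s /\ size_le zi.1 (a * b) /\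
    forall x lab, (0 < s x lab)%coq_nat -> reconstruct C ab0 zi.1 zi.2 x = lab.
  by exists kappa, (reconstruct C ab0).
move=> s; case: (pselect (C_labeled C s)) => [|ns]; last by exists (fun _ _ => 0, 0).
case=> fin [c [Cc sc]].
have [nd ls] := support_seqP fin; move: (support_seq s) nd ls => l nd ls.
(* The empty sample is treated apart, since [maj] wants a nonempty [Y]. *)
case: (posnP (size l)) => [l0|l0].
  exists (fun _ _ => 0, 0) => _ /=; split.
    by apply/ssrnat.ltP; rewrite expn_gt0 ab0.
  split; first by move=> x lab; apply/ssrnat.leP.
  split; first by exists [::]; split; [split; [constructor | move=> x lab /ssrnat.ltP] | apply/ssrnat.leP].
  move=> x lab /ssrnat.ltP sx; have /ls : exists lab, 0 < s x lab by exists lab.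
  by rewrite (size0nil l0).
pose p := tnth (in_tuple l).
have [|u uP] := maj 'I_(size l) p c _ Cc; first by rewrite card_ord.
pose used x := exists ij : 'I_a * 'I_b, p (u ij.1 ij.2) = x.
(* One copy of each training point is kept, even if several learners share it. *)
pose z : sample X := fun x lab => (`[< used x >] && (c x == lab) : nat).
have zP x lab : (0 < z x lab) = `[< used x >] && (c x == lab) by rewrite lt0b.
have p_in y : List.In (p y) l.
  rewrite /p (tnth_nth (p y)) /=; apply: nth_In; exact: ltn_ord.
have s_used x : used x -> 0 < s x (c x).
  by case=> ij <-; have /ls[lab slab] := p_in (u ij.1 ij.2); rewrite (sc _ lab) //; apply/ssrnat.ltP.
have z_fin : finite_sample z.
  exists l; split=> // x lab /ssrnat.ltP; rewrite zP => /andP[/asboolP[ij <-] _]; exact: p_in.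
have [ndz zsP] := support_seqP z_fin.
have size_z : size (support_seq z) <= a * b.
  have -> : a * b = size [seq p (u ij.1 ij.2) | ij <- enum {: 'I_a * 'I_b}].
    by rewrite size_map -cardE card_prod !card_ord.
  apply/ssrnat.leP/(List.NoDup_incl_length ndz) => x /zsP[lab]; rewrite zP => /andP[/asboolP[ij <-] _].
  by apply/List.in_map_iff; exists ij; split=> //; apply/In_mem; rewrite mem_enum.
have /choice[f fP] : forall ij : 'I_a * 'I_b, exists i : 'I_(a * b),
    forall x0, nth x0 (support_seq z) i = p (u ij.1 ij.2).
  move=> ij; have zu : List.In (p (u ij.1 ij.2)) (support_seq z).
    by apply/zsP; exists (c (p (u ij.1 ij.2))); rewrite zP eqxx andbT; apply/asboolP; exists ij.
  have [i iz iP] := In_nth zu.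
  by exists (Ordinal (leq_trans iz size_z)).
pose F : code a b := [ffun ij => f ij].
exists (z, index F (enum (code a b))) => _ /=; split.
  by apply/ssrnat.ltP; rewrite -card_code cardE index_mem mem_enum.
split.
  move=> x lab; apply/ssrnat.leP; rewrite /z; case: asboolP => //= /s_used.
  by case: eqP => // <-.
split.
  exists (support_seq z); split.
    by split=> // x lab /ssrnat.ltP zx; apply/zsP; exists lab.
  apply/ssrnat.leP/(leq_trans _ size_z)/size_along_le => x.
  by rewrite /z; case: `[< _ >]; case: (c x).
move=> x lab sx; have lx : List.In x l by apply/ls; exists lab; apply/ssrnat.ltP.
have [y yl yx] := In_nth lx.
rewrite -(sc _ _ sx); have := uP (Ordinal yl).
have -> : p (Ordinal yl) = x by rewrite /p (tnth_nth x).
move=> <-; rewrite /reconstruct; congr majority; apply/funext => r.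
congr learn; apply/funext => j.
(* A kernel point has a copy labelled [true] exactly when [c] holds there, so the labels of the
   training tuples are recovered. *)
rewrite /decode nth_index ?mem_enum // ffunE fP /= zP eqb_id.
by rewrite (_ : `[< _ >]) //; apply/asboolP; exists (r, j).
Qed.

Lemma expn_pow (m n : nat) : m ^ n = Nat.pow m n.
Proof. by elim: n => //= n <-; rewrite expnS. Qed.

Lemma product_compression : exists2 k, (0 < k)%coq_nat &
  forall (X : Type) (C : (X -> bool) -> Prop) (d dstar : nat),
  VCdim C d -> (0 < d)%coq_nat -> dual_VCdim C dstar -> (0 < dstar)%coq_nat ->
  let M := Nat.mul (Nat.mul k dstar) (Nat.mul k d) in
  compression_scheme C M (Nat.pow M M).
Proof.
have [k k0 maj] := majority_of_learners; exists k; first exact/ssrnat.ltP.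
move=> X C d dstar VC /ssrnat.ltP d0 VC' /ssrnat.ltP ds0 M; rewrite -expn_pow.
apply: compression_scheme_of_majority; first by rewrite !muln_gt0 k0 ds0.
exact: (maj X C d dstar VC d0 VC' ds0).
Qed.

End Compression.

(* Choice of the absolute constant *)
From Stdlib Require Import Reals List.
From Stdlib Require Import Lra.
Open Scope R_scope.

Theorem theorem4 :
  exists a : R, 0 < a /\
    forall (X : Type) (C : (X -> bool) -> Prop) (d dstar : nat),
      countable X ->
      VCdim C d -> (0 < d)%nat ->
      dual_VCdim C dstar -> (0 < dstar)%nat ->
      let k := a * INR dstar * INR d in
      exists kern n : nat,
        compression_scheme C kern n /\
        scheme_size kern n <= k * log2 k.
Proof.
destruct Compression.product_compression as [k k_pos scheme].
assert (k0 := lt_0_INR _ k_pos).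
(* The argument of the bound becomes [2 * M], with [M] the kernel size, and [2 * M * (1 + log2 M)]
   dominates [M + M * log2 M] as [M >= 1]. *)
exists (2 * INR k * INR k); split; [nra|].
intros X C d dstar _ VC d_pos VC' dstar_pos.
specialize (scheme X C d dstar VC d_pos VC' dstar_pos).
set (M := Nat.mul (Nat.mul k dstar) (Nat.mul k d)) in scheme.
exists M, (Nat.pow M M); split; [exact scheme|].
assert (ME : 2 * INR k * INR k * INR dstar * INR d = 2 * INR M)
  by (unfold M; rewrite !mult_INR; ring).
rewrite ME.
assert (M1 : 1 <= INR M).
{ change 1 with (INR 1). apply le_INR. unfold M.
  assert (0 < k * dstar * (k * d))%nat by (repeat apply Nat.mul_pos_pos; assumption).
  assumption. }
unfold scheme_size, log2.
rewrite pow_INR, ln_pow, ln_mult by lra.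
assert (ln2 : 0 < ln 2) by (rewrite <- ln_1; apply ln_increasing; lra).
assert (lnM : 0 <= ln (INR M)).
{ rewrite <- ln_1. destruct (Rle_lt_or_eq_dec _ _ M1) as [H|H].
  - left. apply ln_increasing; lra.
  - rewrite <- H. right; reflexivity. }
assert (0 <= ln (INR M) / ln 2) by (apply Rle_mult_inv_pos; assumption).
replace ((ln 2 + ln (INR M)) / ln 2) with (1 + ln (INR M) / ln 2) by (field; lra).
unfold Rdiv in *; nra.
Qed.
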